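(* Let $q$ be a prime power and $m$ an integer with $q\geq m+2\geq 5$. Let $n>0$, $l\geq 0$, and let $V$ be an $(n+l)$-dimensional vector space over $\mathbb{F}_q$ with a fixed $l$-dimensional subspace $W_1$. Let $\mathscr{F}\subseteq\mathcal{M}(m,k;n+l,n)$ be an intersecting family with covering number $\tau(\mathscr{F})=m$. Define $$t=\begin{cases}\max\{0,2m-1-n\}, & \text{if } k=0,\\ m+k-1, & \text{if } k\geq 1.\end{cases}$$ Then $|\mathscr{F}|\leq N(m,k;2m-1,t;n+l,n)$, and equality holds if and only if $\mathscr{F}$ is the family of all subspaces of type $(m,k)$ contained in $X$ for some subspace $X$ of $V$ of type $(2m-1,t)$.
   Context: A subspace $P$ of $V$ is of type $(m,k)$ if $\dim P=m$ and $\dim(P\cap W_1)=k$. $\mathcal{M}(m,k;n+l,n)$ denotes the set of all subspaces of $V$ of type $(m,k)$. $N(m_1,k_1;m,k;n+l,n)$ denotes the number of subspaces of type $(m_1,k_1)$ contained in a given subspace of type $(m,k)$ of $V$; it equals $q^{(m_1-k_1)(k-k_1)}{m-k\brack m_1-k_1}_q{k\brack k_1}_q$ when $0\leq k_1\leq k\leq l$ and $0\leq m_1-k_1\leq m-k\leq n$, and $0$ otherwise, where ${a\brack b}_q=\prod_{0\le i<b}\frac{q^{a-i}-1}{q^{b-i}-1}$ is the Gaussian binomial coefficient. Two subspaces intersect if their intersection has dimension at least $1$; a family is intersecting if any two members intersect. The covering number $\tau(\mathscr{F})$ is the minimum dimension of a subspace of $V$ intersecting every member of $\mathscr{F}$.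 *)

(* Defs.v *)
From HB Require Import structures.
From mathcomp Require Import all_boot all_order all_algebra.

Set Implicit Arguments.
Unset Strict Implicit.
Unset Printing Implicit Defensive.

Section FinVspace.

(* The subType structure of {vspace V} over square matrices is only exposed by
   this module; it gives {vspace V} finitely many elements over a finite K. *)
Import VectorInternalTheory.

HB.instance Definition _ (K : finFieldType) (V : vectType K) :=
  [Countable of {vspace V} by <:].
HB.instance Definition _ (K : finFieldType) (V : vectType K) :=
  [Finite of {vspace V} by <:].

End FinVspace.

Section SingularLinearSpace.

Variables (K : finFieldType) (V : vectType K).
Implicit Types (W P U X : {vspace V}) (F : {set {vspace V}}).

(* M(m,k;n+l,n), with n + l = \dim {:V} and l = \dim W1. *)
Definition subspaces_of_type W1 (m k : nat) : {set {vspace V}} :=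
  [set P : {vspace V} | (\dim P == m) && (\dim (P :&: W1)%VS == k)].

Definition subspaces_within W1 (m k : nat) X : {set {vspace V}} :=
  [set P in subspaces_of_type W1 m k | (P <= X)%VS].

(* N(m1,k1;m,k;n+l,n). The count does not depend on which subspace X of type
   (m,k) is picked (see numberNE); it is 0 when V has no such X. *)
Definition numberN W1 (m1 k1 m k : nat) : nat :=
  if [pick X in subspaces_of_type W1 m k] is Some X
  then #|subspaces_within W1 m1 k1 X| else 0.

Definition meets P U : bool := (1 <= \dim (P :&: U)%VS).

Definition intersecting F : Prop := {in F &, forall P U, meets P U}.

Definition covers F U : bool := [forall P in F, meets U P].

(* The default fullv covers F unless F contains the zero subspace, which no
   subspace meets. *)
Definition covering_number F : nat :=
  \dim [arg min_(U < fullv | covers F U) \dim U].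

End SingularLinearSpace.

Definition extremal_t (m k n : nat) : nat :=
  if k == 0 then maxn 0 (2 * m - 1 - n) else (m + k - 1)%N.

Section Independence.

Variables (K : finFieldType) (V : vectType K) (W1 : {vspace V}).

Lemma adapted_basis (X : {vspace V}) :
  basis_of fullv ((vbasis (X :\: W1) ++ vbasis (X :&: W1)) ++ vbasis X^C)%VS.
Proof.
rewrite -(addv_complf X); apply: cat_basis; last exact: vbasisP.
  by apply/directv_addP; rewrite capv_compl.
rewrite -{1}(addv_diff_cap X W1); apply: cat_basis; try exact: vbasisP.
by apply/directv_addP; rewrite capvC -capvA [(W1 :&: _)%VS]capvC capv_diff capv0.
Qed.

Lemma type_transitive m k (X1 X2 : {vspace V}) :
    X1 \in subspaces_of_type W1 m k -> X2 \in subspaces_of_type W1 m k ->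
  exists f : 'End(V), [/\ lker f == 0%VS, (f @: X1)%VS = X2
    & (f @: (X1 :&: W1))%VS = (X2 :&: W1)%VS].
Proof.
rewrite !inE => /andP[/eqP d1 /eqP c1] /andP[/eqP d2 /eqP c2].
have eD : \dim (X2 :\: W1) = \dim (X1 :\: W1).
  by apply/eqP; rewrite -(eqn_add2l k) -{1}c2 -c1 !dimv_cap_compl d1 d2.
have b1 := adapted_basis X1; have b2 := adapted_basis X2.
have [g /(_ (basis_free b1))] := linear_of_free
  ((vbasis (X1 :\: W1) ++ vbasis (X1 :&: W1)) ++ vbasis X1^C)%VS
  ((vbasis (X2 :\: W1) ++ vbasis (X2 :&: W1)) ++ vbasis X2^C)%VS.
have eS : size ((vbasis (X2 :\: W1) ++ vbasis (X2 :&: W1)) ++ vbasis X2^C)%VS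
    = size ((vbasis (X1 :\: W1) ++ vbasis (X1 :&: W1)) ++ vbasis X1^C)%VS.
  by rewrite !size_cat !size_tuple eD c1 c2 !dimv_compl d1 d2.
move=> /(_ eS) eg; pose f := linfun g.
have ef : map f ((vbasis (X1 :\: W1) ++ vbasis (X1 :&: W1)) ++ vbasis X1^C)%VS
    = ((vbasis (X2 :\: W1) ++ vbasis (X2 :&: W1)) ++ vbasis X2^C)%VS.
  by rewrite -eg; apply: eq_map => x; rewrite lfunE.
exists f.
have f_full : limg f = fullv.
  by rewrite -{1}(span_basis b1) limg_span ef (span_basis b2).
move/eqP: ef; rewrite !map_cat eqseq_cat; last first.
  by rewrite !size_cat !size_map !size_tuple eD c1 c2.
rewrite eqseq_cat ?size_map ?size_tuple ?eD // => /andP[/andP[/eqP e1 /eqP e2] _].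
have iI : (f @: (X1 :&: W1))%VS = (X2 :&: W1)%VS.
  rewrite -(span_basis (vbasisP (X1 :&: W1))) limg_span e2.
  exact: span_basis (vbasisP _).
split=> //.
  have := limg_ker_dim f fullv; rewrite f_full capfv => /eqP.
  by rewrite -{2}[\dim fullv]add0n eqn_add2r dimv_eq0.
rewrite -(addv_diff_cap X1 W1) limgD iI.
rewrite -(span_basis (vbasisP (X1 :\: W1))) limg_span e1.
by rewrite (span_basis (vbasisP _)) addv_diff_cap.
Qed.

Lemma leq_card_within m1 k1 m k (X1 X2 : {vspace V}) :
    X1 \in subspaces_of_type W1 m k -> X2 \in subspaces_of_type W1 m k ->
  (#|subspaces_within W1 m1 k1 X1| <= #|subspaces_within W1 m1 k1 X2|)%N.
Proof.
move=> t1 t2; have [f [kf fX fW]] := type_transitive t1 t2.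
have injf : injective (fun P : {vspace V} => (f @: P)%VS).
  by move=> P Q /eqP; rewrite eq_limg_ker0 // => /eqP.
have dimf (P : {vspace V}) : \dim (f @: P) = \dim P.
  by apply: limg_dim_eq; rewrite (eqP kf) capv0.
rewrite -(card_imset _ injf); apply/subset_leq_card/subsetP => Q /imsetP[P].
rewrite !inE => /andP[/andP[/eqP dP /eqP dPW] sPX] ->{Q}.
have sfPX : (f @: P <= X2)%VS by rewrite -fX limgS.
rewrite sfPX andbT dimf dP eqxx /= -(capv_idPl sfPX) -capvA -fW.
by rewrite -lker0_img_cap // dimf capvA (capv_idPl sPX) dPW.
Qed.

Lemma numberNE m1 k1 m k (X : {vspace V}) :
  X \in subspaces_of_type W1 m k ->
  numberN W1 m1 k1 m k = #|subspaces_within W1 m1 k1 X|.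
Proof.
move=> tX; rewrite /numberN; case: pickP => [Y tY | /(_ X)]; last by rewrite tX.
by apply/eqP; rewrite eqn_leq !(@leq_card_within _ _ m k).
Qed.

End Independence.

(* Main.v *)
(* Fix a member P missing a given U of dimension less than m: every member
   through U meets P, hence contains U + <y> for some y in P. Iterating this
   from U = 0 gives (q-1)^m |F| <= (q^m-1)^m, which is too weak by a constant
   factor. A factor of about q is gained at dimension m - 1. If every U of that
   dimension is missed by members P, P' with P' not inside U + P, then y is
   confined to a hyperplane of P in the last step. Otherwise some U has all the
   members missing it inside a single (2m-1)-space X, so that members outside X
   meet U, and branching starts from a member outside X, if there is one.
   Either F lies in a (2m-1)-space or |F| < q^(m(m-1)), which is at most
   N(m,k;2m-1,t) by counting complements of a suitable (m-1)-space. *)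
Require Import Defs.
From mathcomp Require Import all_boot all_order all_algebra.
From mathcomp Require Import finfield zify.

Set Implicit Arguments.
Unset Strict Implicit.
Unset Printing Implicit Defensive.

Import GRing.Theory.
Local Open Scope nat_scope.

(** * Counting vectors and complements of subspaces *)

Section Vectors.

Variables (K : finFieldType) (V : vectType K).
Implicit Types (P Q U X : {vspace V}) (G : {set {vspace V}}).
Local Notation q := #|K|.
Local Notation fV := (finvect_type V).

Lemma card_vectors X : #|[set v : fV | v \in X]| = q ^ \dim X.
Proof.
rewrite cardsE; case: V X => T c X.
exact: (@card_vspace K (finvect_type (Vector.Pack c))).
Qed.

Definition nonzero X : {set fV} := [set v : fV | ((v : V) \in X) && (v != 0%R)].

Lemma card_nonzero X : #|nonzero X| = q ^ \dim X - 1.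
Proof.
have X0 : (0%R : fV) \in [set v : fV | v \in X] by rewrite inE; apply: mem0v.
rewrite -card_vectors [in RHS](cardsD1 (0%R : fV)) X0 add1n subn1 /=.
by apply: eq_card => v; rewrite !inE andbC.
Qed.

Lemma meetsC P Q : meets P Q = meets Q P.
Proof. by rewrite /meets capvC. Qed.

Lemma meetsPn P Q : reflect (P :&: Q = 0)%VS (~~ meets P Q).
Proof. by rewrite /meets lt0n negbK dimv_eq0; apply: eqP. Qed.

(** Double counting of pairs of a member [P] and a nonzero vector [y] of [P :&: X]: each
    intersection contains a line, so each member occurs at least [q - 1] times. *)
Lemma incidence_count G X : {in G, forall P, meets P X} ->
  (q - 1) * #|G| <= \sum_(y in nonzero X) #|[set P in G | (y : V) \in P]|.
Proof.
move=> GX; rewrite mulnC -sum_nat_const.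
have -> : \sum_(y in nonzero X) #|[set P in G | (y : V) \in P]|
    = \sum_(y in nonzero X) \sum_(P in G) ((y : V) \in P).
  apply: eq_bigr => y _; rewrite -sum1_card big_mkcond [RHS]big_mkcond.
  by apply: eq_bigr => P _; rewrite inE; case: (P \in G) => //; case: (_ \in P).
rewrite exchange_big /=; apply: leq_sum => P /GX PX.
have -> : \sum_(y in nonzero X) ((y : V) \in P) = #|nonzero (P :&: X)|.
  rewrite -sum1_card big_mkcond [RHS]big_mkcond; apply: eq_bigr => y _.
  by rewrite !inE memv_cap; case: (_ \in X); case: (_ \in P); case: (_ == _).
rewrite card_nonzero leq_sub2r // -{1}[q]expn1 leq_exp2l //.
exact: finNzRing_gt1.
Qed.

Lemma dim_add_line U (y : V) : y \notin U -> \dim (U + <[y]>) = (\dim U).+1.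
Proof.
move=> Uy; have y0 : y != 0%R by apply: contraNneq Uy => ->; exact: mem0v.
rewrite dimv_disjoint_sum ?dim_vline ?y0 ?addn1 //.
apply/eqP; rewrite -subv0; apply/subvP => v /memv_capP[Uv /vlineP[a av]].
rewrite memv0 av; apply: contraR Uy; rewrite scaler_eq0 negb_or => /andP[a0 _].
by rewrite -(scalerK a0 y) -av memvZ.
Qed.

Lemma exists_between U X d : (U <= X)%VS -> \dim U <= d <= \dim X ->
  exists Q : {vspace V}, [/\ (U <= Q)%VS, (Q <= X)%VS & \dim Q = d].
Proof.
move=> UX /andP[]; elim: d => [|d IHd] Ud dX.
  by exists U; split=> //; apply/eqP; rewrite -leqn0.
have [eU | ] := eqVneq (\dim U) d.+1; first by exists U.
move=> nU; have {}Ud : \dim U <= d by lia.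
have [Q [UQ QX dQ]] := IHd Ud (ltnW dX).
have : ~~ (X <= Q)%VS by apply: contraL dX => /dimvS; lia.
case/subvPn => y Xy Qy; exists (Q + <[y]>)%VS; split.
- exact: subv_trans UQ (addvSl _ _).
- by rewrite subv_add QX -memvE.
- by rewrite dim_add_line // dQ.
Qed.

(* The complement [P0] with basis [e] is sheared along a map to [Q]: distinct
   maps give distinct spans [<<e_i + f i>>]. *)
Lemma card_complements Q X : (Q <= X)%VS ->
  q ^ (\dim Q * (\dim X - \dim Q)) <=
  #|[set P : {vspace V} |
      [&& (P <= X)%VS, \dim P == \dim X - \dim Q & (P :&: Q == 0)%VS]]|.
Proof.
move=> QX; pose P0 := (X :\: Q)%VS; pose e := vbasis P0.
have dP0 : \dim P0 = \dim X - \dim Q.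
  by have := dimv_cap_compl X Q; rewrite (capv_idPr QX) -/P0; lia.
pose QS := [set v : fV | v \in Q].
pose s (f : {ffun 'I_(\dim P0) -> fV}) := [seq (e`_i + f i : V)%R | i : 'I_(\dim P0)].
pose g f := <<s f>>%VS.
have ss f : size (s f) = \dim P0 by rewrite size_map size_enum_ord.
have mem_g (f : {ffun 'I_(\dim P0) -> fV}) (i : 'I_(\dim P0)) : (e`_i + f i : V)%R \in g f.
  by apply/memv_span/map_f; rewrite mem_enum.
have fQ (f : {ffun 'I_(\dim P0) -> fV}) i : f \in ffun_on QS -> (f i : V) \in Q.
  by move/ffun_onP=> /(_ i); rewrite inE.
(* The shear changes nothing modulo [Q]. *)
have gX (f : {ffun 'I_(\dim P0) -> fV}) : f \in ffun_on QS -> (g f + Q)%VS = X.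
  move=> Rf; apply: subv_anti; rewrite subv_add QX andbT.
  apply/andP; split.
    apply/span_subvP => _ /mapP[i _ ->]; rewrite memvD //.
      by rewrite (subvP (diffvSl X Q)) // vbasis_mem // mem_nth // size_tuple.
    by rewrite (subvP QX) // fQ.
  rewrite -{1}(addv_diff_cap X Q) subv_add.
  rewrite (subv_trans (capvSr _ _) (addvSr _ _)) andbT.
  rewrite -/P0 -(span_basis (vbasisP P0)); apply/span_subvP => v /(nthP 0%R)[i].
  rewrite size_tuple => ltiP <-; pose j := Ordinal ltiP.
  rewrite -[X0 in X0 \in _](addrK (f j : V)) memv_add ?memvN ?fQ //.
  exact: (mem_g f j).
(* Only [\dim P0] vectors span [g f], so generating [X] together with [Q] leaves no room for an
   intersection. *)
have dg (f : {ffun 'I_(\dim P0) -> fV}) : f \in ffun_on QS -> \dim (g f) = \dim P0 /\ (g f :&: Q = 0)%VS.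
  move=> Rf; have := dimv_sum_cap (g f) Q; rewrite gX //.
  have := dim_span (s f); rewrite ss -/(g f) => le1 eq1.
  have : \dim (g f :&: Q) == 0 by move: eq1 le1; have := dimvS QX; lia.
  rewrite dimv_eq0 => /eqP c0; split=> //.
  by move: eq1; rewrite c0 dimv0; lia.
have inj_g : {in ffun_on QS &, injective g}.
  move=> f1 f2 R1 R2 eg; apply/ffunP => i; apply/eqP; rewrite -subr_eq0.
  rewrite -(memv0 (f1 i - f2 i : V)%R) -(dg _ R1).2.
  apply/memv_capP; split; last by rewrite memvB ?fQ.
  have -> : (f1 i - f2 i : V)%R = ((e`_i + f1 i) - (e`_i + f2 i) : V)%R.
    by rewrite opprD addrACA subrr add0r.
  by rewrite memvB // ?mem_g // eg mem_g.
have -> : q ^ (\dim Q * (\dim X - \dim Q)) = #|[set f : {ffun 'I_(\dim P0) -> fV} in ffun_on QS]|.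
  by rewrite cardsE card_ffun_on card_ord card_vectors -expnM dP0.
rewrite -(card_in_imset (f := g)); last first.
  by move=> f1 f2; rewrite !inE; apply: inj_g.
apply/subset_leq_card/subsetP => P /imsetP[f]; rewrite inE => Rf ->{P}.
have [d1 d2] := dg f Rf; rewrite inE d1 d2 dP0 !eqxx !andbT.
by rewrite -[X0 in (_ <= X0)%VS](gX f Rf) addvSl.
Qed.

End Vectors.

(** * Branching through members that miss a given subspace *)

Section MaximalCovering.

Variables (K : finFieldType) (V : vectType K).
Variables (m : nat) (F : {set {vspace V}}).
Implicit Types (P Q U X : {vspace V}).
Local Notation q := #|K|.
Local Notation fV := (finvect_type V).

Hypothesis m_gt1 : 1 < m.
Hypothesis dimF : {in F, forall P, \dim P = m}.
Hypothesis intF : intersecting F.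
Hypothesis missedF : forall U, \dim U < m -> exists2 P, P \in F & ~~ meets P U.

Definition star U : {set {vspace V}} := [set P in F | (U <= P)%VS].

Lemma star_line U (y : V) :
  [set P in star U | y \in P] = star (U + <[y]>)%VS.
Proof. by apply/setP => P; rewrite !inE subv_add -memvE andbA. Qed.

Lemma star_meets U P : P \in F -> {in star U, forall Q, meets Q P}.
Proof. by move=> FP Q; rewrite inE => /andP[FQ _]; apply: intF. Qed.

Lemma notin_nonzero U P (y : fV) :
  (P :&: U = 0)%VS -> y \in nonzero P -> (y : V) \notin U.
Proof.
move=> PU0; rewrite inE => /andP[Py]; apply: contra => Uy.
have : (y : V) \in (P :&: U)%VS by rewrite memv_cap Py.
by rewrite PU0 memv0.
Qed.

(** Each of the [j] steps picks a member [P] missing [U]: every member through [U] contains at least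
    [q - 1] of the [q ^ m - 1] nonzero vectors of [P]. The last [i] dimensions are left to [base],
    so that a sharper bound can be supplied there. *)
Lemma star_induction i j B :
    (forall U, \dim U + i = m -> (q - 1) ^ i * #|star U| <= B) ->
  forall U, \dim U + (i + j) = m ->
    (q - 1) ^ (i + j) * #|star U| <= B * (q ^ m - 1) ^ j.
Proof.
move=> base; elim: j => [|j IHj] U dU.
  by rewrite addn0 muln1; apply: base; rewrite -dU addn0.
have [P FP /meetsPn PU] : exists2 P, P \in F & ~~ meets P U.
  by apply: missedF; lia.
have count := incidence_count (star_meets (U := U) FP).
rewrite addnS expnSr -mulnA (leq_trans (leq_mul (leqnn _) count)) //.
rewrite big_distrr /= expnSr mulnA -[X in _ <= _ * X](_ : #|nonzero P| = _).
  rewrite mulnC -sum_nat_const; apply: leq_sum => y Py; rewrite star_line.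
  apply: IHj; rewrite dim_add_line ?(notin_nonzero PU) //; lia.
by rewrite card_nonzero (dimF FP).
Qed.

Lemma star_le1 U : \dim U = m -> #|star U| <= 1.
Proof.
move=> dU; rewrite -(cards1 U); apply/subset_leq_card/subsetP => P.
rewrite !inE => /andP[FP UP]; rewrite eq_sym.
by rewrite eqEdim UP dimF // dU leqnn.
Qed.

Lemma star_bound j U : \dim U + j = m ->
  (q - 1) ^ j * #|star U| <= (q ^ m - 1) ^ j.
Proof.
move=> dU; rewrite -[(q ^ m - 1) ^ j]mul1n -[in (q - 1) ^ j](add0n j).
apply: star_induction => // U'; rewrite addn0 mul1n; exact: star_le1.
Qed.

(** A member [Q] through [U] meets [P'] outside [U], so [Q = U + (Q :&: P')] lies in [U + P']. Hence
    [Q] meets [P] inside [P :&: (U + P')], which is proper in [P] because [U + P] and [U + P'] are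
    distinct of equal dimension. *)
Lemma star_hyperplane U P P' :
    \dim U + 1 = m -> P \in F -> P' \in F -> ~~ meets P U -> ~~ meets P' U ->
    ~~ (P' <= U + P)%VS ->
  (q - 1) ^ 1 * #|star U| <= q ^ (m - 1) - 1.
Proof.
move=> dU FP FP' /meetsPn PU /meetsPn P'U nP'.
have dUP : \dim (U + P) = \dim (U + P').
  by rewrite !dimv_disjoint_sum ?(dimF FP) ?(dimF FP') // capvC.
pose C := (P :&: (U + P'))%VS.
have dC : \dim C <= m - 1.
  have : ~~ (P <= C)%VS.
    apply: contra nP' => PC; suff -> : (U + P)%VS = (U + P')%VS by apply: addvSr.
    apply/eqP; rewrite eqEdim dUP leqnn andbT subv_add addvSl.
    exact: subv_trans PC (capvSr _ _).
  rewrite -(dimv_leqif_sup (capvSl P (U + P'))) (dimF FP) -/C.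
  by have := dimvS (capvSl P (U + P')%VS); rewrite (dimF FP) -/C; lia.
have starC : {in star U, forall Q, meets Q C}.
  move=> Q; rewrite inE => /andP[FQ UQ].
  suff QP' : (Q <= U + P')%VS.
    rewrite /meets /C capvA [(Q :&: P)%VS]capvC -capvA (capv_idPl QP') capvC.
    exact: intF.
  have <- : (U + (Q :&: P'))%VS = Q; last by rewrite addvS // capvSr.
  apply/eqP; rewrite eqEdim subv_add UQ capvSl dimv_disjoint_sum; last first.
    apply/eqP; rewrite -subv0 -P'U subv_cap capvSl andbT.
    exact: subv_trans (capvSr _ _) (capvSr _ _).
  by have := intF FQ FP'; rewrite /meets (dimF FQ); lia.
rewrite expn1 (leq_trans (incidence_count starC)) //.
apply: (@leq_trans #|nonzero C|).
  rewrite -sum1_card; apply: leq_sum => y Cy; rewrite star_line star_le1 //.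
  have Py : y \in nonzero P.
    by move: Cy; rewrite !inE memv_cap => /andP[/andP[-> _] ->].
  by rewrite dim_add_line ?(notin_nonzero PU) // -addn1.
rewrite card_nonzero leq_sub2r // leq_pexp2l //; exact: ltnW (finNzRing_gt1 K).
Qed.

(* Every member outside [X] meets [U]; counting through a member [C] outside
   [X], each first choice of a vector of [C] outside [X] can therefore be
   followed by one in the smaller space [U]. *)
Lemma star_outside U X C : \dim U + 1 = m -> (U <= X)%VS ->
    {in F, forall P, ~~ (P <= X)%VS -> meets P U} ->
    C \in F -> ~~ (C <= X)%VS ->
  (q - 1) ^ m * #|F| <= 2 * ((q ^ (m - 1) - 1) * (q ^ m - 1) ^ (m - 1)).
Proof.
move=> dU UX outF FC nCX.
set b := q ^ (m - 1) - 1; set A := q ^ m - 1.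
have starE (x : fV) : [set P in F | (x : V) \in P] = star <[x : V]>.
  by apply/setP => P; rewrite !inE.
have dCX : \dim (C :&: X) <= m - 1.
  have := dimv_leqif_sup (capvSl C X); rewrite (dimF FC) subv_cap subvv /=.
  by move=> [le1 /esym]; rewrite (negPf nCX) => /eqP; lia.
have inX : (q - 1) ^ m * #|F| <=
    \sum_(x in nonzero C) (q - 1) ^ (m - 1) * #|star <[x : V]>|.
  have eqm : m = (m - 1).+1 by lia.
  rewrite [in (q - 1) ^ m]eqm expnSr -mulnA -big_distrr leq_mul2l; apply/orP; right.
  apply: leq_trans (incidence_count (X := C) _) _; first by move=> P FP; apply: intF.
  by apply: leq_sum => x _; rewrite starE.
apply: leq_trans inX _.
(* The two halves give the factor 2: at most [b] vectors of [C] lie in [X], and each of the others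
   allows only [b] second choices, taken in [U]. *)
rewrite (bigID (fun x : fV => (x : V) \in X)) /= mul2n -addnn; apply: leq_add.
  apply: (@leq_trans (\sum_(x in nonzero (C :&: X)) A ^ (m - 1))).
    rewrite [X0 in X0 <= _](eq_bigl (fun x => x \in nonzero (C :&: X))); last first.
      move=> x; rewrite !inE memv_cap.
      by case: (_ \in X); case: (_ \in C); case: (_ == _).
    apply: leq_sum => x; rewrite inE => /andP[_ x0].
    by apply: star_bound; rewrite dim_vline x0; lia.
  rewrite sum_nat_const card_nonzero leq_mul2r; apply/orP; right.
  by rewrite leq_sub2r // leq_pexp2l // ltnW ?finNzRing_gt1.
apply: (@leq_trans (\sum_(x in nonzero C) b * A ^ (m - 2))); last first.
  rewrite sum_nat_const card_nonzero (dimF FC) mulnCA leq_mul2l -expnS.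
  by apply/orP; right; have -> : (m - 2).+1 = m - 1 by lia.
rewrite [X0 in _ <= X0](bigID (fun x : fV => (x : V) \in X)) /=.
rewrite -[X0 in X0 <= _]add0n leq_add //.
apply: leq_sum => x /andP[Cx nXx].
have starU : {in star <[x : V]>, forall Q, meets Q U}.
  move=> Q; rewrite inE => /andP[FQ xQ]; apply: outF => //.
  by apply: contra nXx => /(subv_trans xQ); rewrite -memvE.
have -> : (q - 1) ^ (m - 1) = (q - 1) ^ (m - 2) * (q - 1).
  by rewrite -expnSr; congr (_ ^ _); lia.
rewrite -mulnA (leq_trans (leq_mul (leqnn _) (incidence_count starU))) //.
rewrite big_distrr /=.
have -> : b = #|nonzero U|.
  by rewrite card_nonzero /b; congr (_ ^ _ - 1); lia.
rewrite -sum_nat_const; apply: leq_sum => y Uy; rewrite star_line.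
(* [y] is not a multiple of [x], since [U] lies in [X] and [x] does not. *)
apply: star_bound; rewrite dim_add_line; last first.
  apply/negP => /vlineP[a ya]; move: Uy; rewrite inE ya => /andP[Uax].
  rewrite scaler_eq0 negb_or => /andP[a0 _].
  by rewrite -(scalerK a0 (x : V)) memvZ // (subvP UX) in nXx.
by move: Cx; rewrite inE dim_vline => /andP[_ ->]; lia.
Qed.

(** Absorbs both the factor 2 of [star_outside] and the loss from dividing by [(q - 1) ^ m]. *)
Lemma pow_pred_bound : m + 2 <= q -> 2 * q ^ (m - 1) <= (q - 1) ^ m.
Proof.
move=> qm.
(* Bernoulli: [(1 - 1/q)^j >= 1 - j/q] *)
have bernoulli j : j <= q -> q ^ j * (q - j) <= (q - 1) ^ j * q.
  elim: j => [|j IHj] jq; first by rewrite !expn0 subn0.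
  have {}IHj := IHj (ltnW jq); rewrite !expnS.
  apply: (@leq_trans ((q - 1) * (q ^ j * (q - j)))); last first.
    by rewrite -mulnA leq_mul2l IHj orbT.
  rewrite [q * _]mulnC [(q - 1) * _]mulnC -!mulnA leq_mul2l; apply/orP; right.
  nia.
have := bernoulli (m - 1) _; set a := q ^ _; set c := (q - 1) ^ (m - 1).
have -> : (q - 1) ^ m = c * (q - 1) by rewrite /c -expnSr; congr (_ ^ _); lia.
move=> /(_ ltac:(lia)) h.
(* [m + 2 <= q] makes [q - (m - 1)] at least 3. The goal then follows from
   [2 * q <= 3 * (q - 1)]. *)
have h3 : 3 * a <= c * q.
  by apply: leq_trans h; rewrite mulnC leq_mul2l; apply/orP; right; lia.
nia.
Qed.

Lemma contained_or_small : m + 2 <= q ->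
  (exists2 X : {vspace V}, \dim X = 2 * m - 1 & {in F, forall P, (P <= X)%VS})
  \/ #|F| < q ^ (m * (m - 1)).
Proof.
move=> qm; have q_gt1 : 1 < q := finNzRing_gt1 K.
suff : (exists2 X : {vspace V}, \dim X = 2 * m - 1 & {in F, forall P, (P <= X)%VS})
    \/ (q - 1) ^ m * #|F| <= 2 * ((q ^ (m - 1) - 1) * (q ^ m - 1) ^ (m - 1)).
  case; [by left | move=> le; right].
  have q1 : 0 < (q - 1) ^ m by rewrite expn_gt0; lia.
  rewrite -(ltn_pmul2l q1); apply: leq_ltn_trans le _.
  apply: (@leq_trans (2 * q ^ (m - 1) * q ^ (m * (m - 1)))); last first.
    by rewrite leq_mul2r pow_pred_bound ?orbT.
  rewrite -mulnA ltn_pmul2l //.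
  apply: (@leq_ltn_trans ((q ^ (m - 1) - 1) * q ^ (m * (m - 1)))).
    by rewrite leq_mul2l expnM leq_exp2r ?leq_subr ?orbT //; lia.
  rewrite ltn_pmul2r ?expn_gt0 ?(ltnW q_gt1) //.
  by rewrite subn1 ltn_predL expn_gt0 ltnW.
pose conc U X := {in F, forall P, ~~ meets P U -> (P <= X)%VS}.
pose spread U := [exists P in F, [exists P' in F,
  [&& ~~ meets P U, ~~ meets P' U & ~~ (P' <= U + P)%VS]]].
have [/existsP[U /andP[/eqP dU nspU]] | allspread] :=
    boolP [exists U : {vspace V}, (\dim U + 1 == m) && ~~ spread U].
  have [P FP PU] : exists2 P, P \in F & ~~ meets P U by apply: missedF; lia.
  have inX : {in F, forall P', ~~ meets P' U -> (P' <= U + P)%VS}.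
    move=> P' FP' P'U; apply: contraR nspU => nP'.
    apply/existsP; exists P; rewrite FP; apply/existsP; exists P'.
    by rewrite FP' PU P'U.
  have dX : \dim (U + P) = 2 * m - 1.
    by rewrite dimv_disjoint_sum ?(dimF FP) 1?capvC; [lia | apply/meetsPn].
  have [/forallP allX | ] := boolP [forall C, (C \in F) ==> (C <= U + P)%VS].
    by left; exists (U + P)%VS => // C FC; apply: (implyP (allX C)).
  rewrite negb_forall => /existsP[C]; rewrite negb_imply => /andP[FC nC].
  right; apply: (@star_outside U (U + P)%VS C) => //; first exact: addvSl.
  by move=> Q FQ; apply: contraR => /(inX _ FQ) ->.
(* Every [U] of dimension [m - 1] is now spread, so [star_hyperplane] serves as the base case
   [i = 1]. *)
right; have -> : F = star 0%VS.
  by apply/setP => P; rewrite inE sub0v andbT.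
have {1}-> : m = 1 + (m - 1) by lia.
apply: (@leq_trans ((q ^ (m - 1) - 1) * (q ^ m - 1) ^ (m - 1))); last by rewrite leq_pmull.
apply: star_induction; last by rewrite dimv0; lia.
move=> U dU; move: allspread; rewrite negb_exists => /forallP/(_ U).
rewrite dU eqxx negbK => /existsP[P /andP[FP /existsP[P' /andP[FP']]]].
move=> /and3P[PU P'U nP']; exact: (@star_hyperplane U P P').
Qed.

End MaximalCovering.

(** * Existence and counting of subspaces of a given type *)

Section SubspaceTypes.

Variables (K : finFieldType) (V : vectType K).
Implicit Types (P Q T U X W : {vspace V}).

(** Add to [T] a subspace [S] of a complement of [W]; the modular law gives the intersection with
    [W]. *)
Lemma exists_over W T d : (T <= W)%VS ->
    \dim T <= d <= \dim {:V} - \dim W + \dim T ->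
  exists X : {vspace V}, \dim X = d /\ (X :&: W)%VS = T.
Proof.
move=> TW /andP[Td dW].
have [] := @exists_between _ _ 0%VS (W^C)%VS (d - \dim T) (sub0v _).
  by rewrite dimv0 dimv_compl; lia.
move=> S [_ SW dS].
have SW0 : (S :&: W = 0)%VS.
  by apply/eqP; rewrite -subv0 -(capv_compl W) capvC capvS.
have capX : ((T + S) :&: W)%VS = T by rewrite -vspace_modl // SW0 addv0.
exists (T + S)%VS; split=> //; rewrite dimv_disjoint_sum ?dS; first lia.
by apply/eqP; rewrite -subv0 -SW0 capvC capvS.
Qed.

(* The complements in [X] of a suitable [Q] all have type [(m, k)]: [Q]
   contains [X :&: W] when [k = 0], and lies in it when [k > 0]. *)
Lemma card_within_ge W m k X : 0 < m -> k <= m -> \dim X = 2 * m - 1 ->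
    (if k == 0 then \dim (X :&: W) <= m - 1 else \dim (X :&: W) == m + k - 1) ->
  #|K| ^ (m * (m - 1)) <= #|subspaces_within W m k X|.
Proof.
move=> m0 km dX dXW.
have [Q [QX dQ compl_type]] : exists Q : {vspace V}, [/\ (Q <= X)%VS,
    \dim Q = m - 1 & forall P, (P <= X)%VS -> \dim P = m -> (P :&: Q = 0)%VS ->
    \dim (P :&: W) = k].
  case: eqP dXW => [-> | /eqP k0] /= dXW.
    have [||Q [XWQ QX dQ]] := @exists_between _ _ (X :&: W)%VS X (m - 1).
    - exact: capvSl.
    - by rewrite dXW dX; lia.
    exists Q; split=> // P PX dP PQ; apply/eqP; rewrite dimv_eq0 -subv0 -PQ.
    by rewrite subv_cap capvSl (subv_trans _ XWQ) // capvS.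
  have [||Q [_ QXW dQ]] := @exists_between _ _ 0%VS (X :&: W)%VS (m - 1).
  - exact: sub0v.
  - by rewrite dimv0 (eqP dXW); lia.
  exists Q; split=> //; first exact: subv_trans QXW (capvSl _ _).
  move=> P PX dP PQ.
  have -> : (P :&: W)%VS = (P :&: (X :&: W))%VS by rewrite capvA (capv_idPl PX).
  (* [P + (X :&: W)] fits in [X], which gives at least [k]; [Q] is disjoint from [P] inside
     [X :&: W], which gives at most [k]. *)
  have low := dimv_sum_cap P (X :&: W).
  have sumX : \dim (P + (X :&: W)) <= \dim X.
    by apply: dimvS; rewrite subv_add PX capvSl.
  have high := dimv_sum_cap (P :&: (X :&: W)) Q.
  have sumW : \dim ((P :&: (X :&: W)) + Q) <= \dim (X :&: W).
    by apply: dimvS; rewrite subv_add capvSr QXW.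
  have cap0 : \dim ((P :&: (X :&: W)) :&: Q) = 0.
    apply/eqP; rewrite dimv_eq0 -subv0 -PQ subv_cap capvSr andbT.
    exact: subv_trans (capvSl _ _) (capvSl _ _).
  by move: dXW => /eqP; lia.
have := card_complements QX; have -> : \dim X - \dim Q = m by lia.
rewrite dQ mulnC => /leq_trans; apply; apply/subset_leq_card/subsetP => P.
rewrite !inE => /and3P[PX /eqP dP /eqP PQ].
by rewrite PX dP eqxx (compl_type P) // eqxx.
Qed.

(** Shrink [X :&: W] to a [t]-dimensional [T0]. Avoiding [T0] is weaker than avoiding [W] inside
    [X], but equivalent inside some [Y] with [Y :&: W = T0]. Relative to [T0], [X] and [Y] have the
    same type, hence equal counts. *)
Lemma within_type0_lt W m d t X : 0 < m -> m + t <= d -> \dim X = d ->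
    t < \dim (X :&: W) -> d - t <= \dim {:V} - \dim W ->
  #|subspaces_within W m 0 X| < numberN W m 0 d t.
Proof.
move=> m0 mt dX tXW dW; have td : t < d by rewrite -dX (leq_trans tXW) ?dimvS ?capvSl.
have [|T0 [_ T0XW dT0]] := @exists_between _ _ 0%VS (X :&: W)%VS t (sub0v _).
  by rewrite dimv0 (ltnW tXW).
have [T0X T0W] : (T0 <= X)%VS /\ (T0 <= W)%VS.
  by move: T0XW; rewrite subv_cap => /andP.
have [|Y [dY YW]] := @exists_over W T0 d T0W; first by lia.
have tY : Y \in subspaces_of_type W d t by rewrite inE dY YW dT0 !eqxx.
have YT0 : (Y :&: T0)%VS = T0 by rewrite -YW capvA capvv.
have tY0 : Y \in subspaces_of_type T0 d t by rewrite inE dY YT0 dT0 !eqxx.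
have tX0 : X \in subspaces_of_type T0 d t.
  by rewrite inE dX (capv_idPr T0X) dT0 !eqxx.
have eqY : subspaces_within W m 0 Y = subspaces_within T0 m 0 Y.
  apply/setP => P; rewrite !inE; case: (boolP (P <= Y)%VS); rewrite ?andbF //.
  by move=> PY; rewrite -YW capvA (capv_idPl PY).
rewrite (numberNE m 0 tY) eqY.
apply: leq_trans (leq_card_within m 0 tX0 tY0); apply: proper_card.
apply/properP; split.
  apply/subsetP => P; rewrite !inE => /andP[/andP[-> dPW] ->]; rewrite andbT /=.
  by rewrite -leqn0 -(eqP dPW) dimvS // capvS.
have : ~~ (X :&: W <= T0)%VS by apply: contraL tXW => /dimvS; rewrite dT0 -leqNgt.
case/subvPn => v XWv T0v.
have [Xv Wv] : v \in X /\ v \in W by apply/memv_capP.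
(* For strictness: [<[v]> + C] is a complement of [T0] in [X], of dimension [d - t >= m]. An
   [m]-space of it through [v] avoids [T0] but meets [W]. *)
pose C := (X :\: (T0 + <[v]>))%VS.
have T0vX : (T0 + <[v]> <= X)%VS by rewrite subv_add T0X -memvE.
have dC : \dim C = d - t.+1.
  have := dimv_cap_compl X (T0 + <[v]>)%VS; rewrite (capv_idPr T0vX) -/C.
  by rewrite dim_add_line // dT0 dX; lia.
have v0 : v != 0%R by apply: contraNneq T0v => ->; exact: mem0v.
have sumD : (T0 + (<[v]> + C))%VS = X.
  by rewrite addvA addvC /C addv_diff; apply/addv_idPl.
have D0 : (T0 :&: (<[v]> + C) = 0)%VS.
  apply/eqP; rewrite -dimv_eq0.
  have := dimv_sum_cap T0 (<[v]> + C)%VS; rewrite sumD.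
  have [le _] := dimv_add_leqif <[v]>%VS C.
  by move: le; rewrite dim_vline v0 /= dC dT0 dX; lia.
have dD : \dim (<[v]> + C) = d - t.
  by have := dimv_disjoint_sum D0; rewrite sumD dX dT0; lia.
have [||P [vP PD dP]] := @exists_between _ _ <[v]>%VS (<[v]> + C)%VS m.
- exact: addvSl.
- by rewrite dim_vline v0 dD; lia.
exists P.
  rewrite !inE dP eqxx /= dimv_eq0 -subv0 -D0 capvC capvS //=.
  by rewrite -sumD (subv_trans PD) // addvSr.
rewrite !inE negb_and negb_and dimv_eq0; apply/orP; left; apply/orP; right.
apply: contra v0 => /eqP PW0; rewrite -memv0 -PW0 memv_cap Wv andbT.
by rewrite memvE.
Qed.

End SubspaceTypes.

(** * Consequences of the covering number *)

Section CoveringNumber.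

Variables (K : finFieldType) (V : vectType K) (m : nat) (F : {set {vspace V}}).

(** As [0 < m], [fullv] covers [F], so the arg min is a genuine minimum over covering subspaces. *)
Lemma covering_number_missed :
    0 < m -> {in F, forall P, \dim P = m} -> covering_number F = m ->
  forall U : {vspace V}, \dim U < m -> exists2 P, P \in F & ~~ meets P U.
Proof.
move=> m0 dimF tauF U dU.
have covf : covers F fullv.
  by apply/forallP => P; apply/implyP => FP; rewrite /meets capfv dimF.
have : ~~ covers F U.
  apply/negP => covU; move: tauF; rewrite /covering_number.
  by case: arg_minnP => // X _ /(_ U covU); lia.
rewrite negb_forall => /existsP[P]; rewrite negb_imply => /andP[FP PU].
by exists P; rewrite // meetsC.
Qed.

(* Otherwise a subspace of [T] of codimension [k - 1] would meet all of [F]. *)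
Lemma dim_of_common_cap k (T : {vspace V}) :
    (forall U : {vspace V}, \dim U < m -> exists2 P, P \in F & ~~ meets P U) ->
    0 < m -> 0 < k -> {in F, forall P, \dim (P :&: T) = k} ->
  m + k - 1 <= \dim T.
Proof.
move=> missedF m0 k0 capF; rewrite leqNgt; apply/negP => dT.
have [|U [_ UT dU]] := @exists_between _ _ 0%VS T (\dim T - (k - 1)) (sub0v _).
  by rewrite dimv0 leq_subr.
have [|P FP /meetsPn PU] := missedF U; first by lia.
have := dimv_sum_cap (P :&: T) U; rewrite (capF _ FP) -capvA (capv_idPr UT) PU.
have : \dim ((P :&: T) + U) <= \dim T by apply: dimvS; rewrite subv_add capvSr.
have : k <= \dim T by rewrite -(capF _ FP) dimvS // capvSr.
by rewrite dimv0 dU; lia.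
Qed.

End CoveringNumber.

Theorem theorem3p1 (K : finFieldType) (q m k n l : nat) (V : vectType K)
    (W1 : {vspace V}) (F : {set {vspace V}})
    (hq : #|K| = q) (hqm : (m + 2 <= q)%N) (hm : (5 <= m + 2)%N)
    (hn : (0 < n)%N)
    (hV : \dim {:V} = (n + l)%N) (hW1 : \dim W1 = l)
    (hF : F \subset subspaces_of_type W1 m k)
    (hint : intersecting F) (htau : covering_number F = m) :
  let t := extremal_t m k n in
  (#|F| <= numberN W1 m k (2 * m - 1) t)%N /\
  (#|F| = numberN W1 m k (2 * m - 1) t <->
   exists2 X : {vspace V},
     X \in subspaces_of_type W1 (2 * m - 1) t & F = subspaces_within W1 m k X).
Proof.
move=> t; subst q.
have typeF P : P \in F -> \dim P = m /\ \dim (P :&: W1) = k.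
  by move=> /(subsetP hF); rewrite inE => /andP[/eqP -> /eqP ->].
have dimF : {in F, forall P, \dim P = m} by move=> P /typeF[].
have missedF := covering_number_missed (ltac:(lia) : 0 < m) dimF htau.
have [P0 FP0 _] : exists2 P, P \in F & ~~ meets P 0%VS.
  by apply: missedF; rewrite dimv0; lia.
(* Some member misses a given [(m - 1)]-space, and their sum is direct. *)
have dimV : 2 * m - 1 <= n + l.
  have [|U [_ _ dU]] := @exists_between _ _ 0%VS P0 (m - 1) (sub0v _).
    by rewrite dimv0 dimF // leq_subr.
  have [|P FP /meetsPn PU] := missedF U; first by lia.
  have := dimvS (subvf (P + U)); rewrite hV dimv_disjoint_sum // dU dimF //; lia.
have [dP0 cP0] := typeF _ FP0.
have km : k <= m by rewrite -cP0 -dP0 dimvS // capvSl.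
have kmn : m - k <= n.
  have := dimv_sum_cap P0 W1; have := dimvS (subvf (P0 + W1)).
  by rewrite hV dP0 cP0 hW1; lia.
(* For [k = 0] this is [dimV]; for [k > 0], every member meets [W1] in dimension [k], so
   [dim_of_common_cap] bounds [\dim W1] below. *)
have tl : t <= l.
  rewrite /t /extremal_t; case: eqP => [_ | /eqP k0]; first lia.
  rewrite -hW1; apply: dim_of_common_cap missedF _ _ _; [lia | lia | ].
  by move=> P /typeF[].
have tn : 2 * m - 1 - t <= n.
  by rewrite /t /extremal_t; case: eqP; lia.
have tm : t <= 2 * m - 1 by rewrite /t /extremal_t; case: eqP; lia.
have [X0 tX0] : exists X0, X0 \in subspaces_of_type W1 (2 * m - 1) t.
  have [|T [_ TW dT]] := @exists_between _ _ 0%VS W1 t (sub0v _).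
    by rewrite dimv0 hW1.
  have [|X [dX XW]] := @exists_over _ _ W1 T (2 * m - 1) TW.
    by rewrite dT hV hW1; lia.
  by exists X; rewrite inE dX XW dT !eqxx.
have N_ge : #|K| ^ (m * (m - 1)) <= numberN W1 m k (2 * m - 1) t.
  rewrite (numberNE _ _ tX0); move: tX0; rewrite inE => /andP[/eqP dX /eqP dXW].
  apply: card_within_ge => //; first by lia.
  by rewrite dXW /t /extremal_t; case: eqP; lia.
have [[X dX FX] | small] := @contained_or_small _ _ m F ltac:(lia) dimF hint missedF hqm.
  have FsX : F \subset subspaces_within W1 m k X.
    by apply/subsetP => P FP; rewrite inE (subsetP hF) // FX.
  have [tX | ntX] := eqVneq (\dim (X :&: W1)) t.
    have typeX : X \in subspaces_of_type W1 (2 * m - 1) t.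
      by rewrite inE dX tX !eqxx.
    split; first by rewrite (numberNE _ _ typeX) subset_leq_card.
    split=> [eqN | [Y tY ->]]; last by rewrite (numberNE _ _ tY).
    exists X => //; apply/eqP; rewrite eqEcard FsX eqN (numberNE _ _ typeX) /=.
    exact: leqnn.
  have small : #|F| < numberN W1 m k (2 * m - 1) t.
    apply: leq_ltn_trans (subset_leq_card FsX) _.
    case: (posnP k) => [k0 | k_gt0].
      (* The dimension formula in [V] already forces at least [t], so a wrong type means a larger
         intersection and strictly fewer subspaces. *)
      have tX : t < \dim (X :&: W1).
        rewrite ltn_neqAle eq_sym ntX /= /t /extremal_t k0 /=.
        have := dimv_sum_cap X W1; have := dimvS (subvf (X + W1)).
        by rewrite hV hW1 dX; lia.
      rewrite k0; apply: within_type0_lt => //; first by lia.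
        by rewrite /t /extremal_t k0 /=; lia.
      by rewrite hV hW1; lia.
    (* For [k > 0] no other type can occur: [P0 + (X :&: W1)] inside [X] gives the upper bound,
       [dim_of_common_cap] the lower one. *)
    case/negP: ntX; rewrite /t /extremal_t gtn_eqF // eqn_leq; apply/andP; split.
      have := dimv_sum_cap P0 (X :&: W1).
      rewrite capvA (capv_idPl (FX _ FP0)) cP0 dP0.
      have : \dim (P0 + (X :&: W1)) <= \dim X.
        by apply: dimvS; rewrite subv_add FX // capvSl.
      by rewrite dX; lia.
    apply: dim_of_common_cap missedF _ k_gt0 _; [lia | move=> P FP].
    by rewrite capvA (capv_idPl (FX _ FP)); case: (typeF _ FP).
  split; first exact: ltnW.
  split=> [eqN | [Y tY eqF]]; first by move: small; rewrite eqN ltnn.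
  by move: small; rewrite (numberNE _ _ tY) -eqF ltnn.
have {small} lt : #|F| < numberN W1 m k (2 * m - 1) t by exact: leq_trans small N_ge.
split; first exact: ltnW.
split=> [eqN | [Y tY eqF]]; first by move: lt; rewrite eqN ltnn.
by move: lt; rewrite (numberNE _ _ tY) -eqF ltnn.
Qed.
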